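(* For bipartite graphs $G$ with $\Delta(G)\le\Delta$, as $\Delta\to\infty$, $$\chi^\star_c(G) \le (1+o(1))\, \frac{\Delta}{\log \Delta} .$$
   Context: Graphs are finite and simple; $\Delta(G)$ is the maximum degree of $G$ and $\log$ is the natural logarithm. The $o(1)$ term depends only on $\Delta$: for every $\varepsilon>0$ there is $\Delta_0$ such that for all $\Delta\ge\Delta_0$ the inequality holds with $1+\varepsilon$ in place of $1+o(1)$ for every bipartite graph $G$ with $\Delta(G)\le\Delta$. A $k$-fold correspondence-cover of $G$ via $L$ is a graph $H$ together with a mapping $L:V(G)\to 2^{V(H)}$ such that the sets $L(v)$, $v\in V(G)$, partition $V(H)$, $|L(v)|=k$ for every $v$, for every edge $vv'\in E(G)$ the edges of $H$ between $L(v)$ and $L(v')$ form a (possibly empty) matching, and for distinct nonadjacent $v,v'$ there is no edge of $H$ between $L(v)$ and $L(v')$. An independent transversal of $H$ with respect to $L$ (a correspondence $L$-colouring) is a set consisting of exactly one vertex from each $L(v)$ having no two members $x\in L(v)$, $y\in L(v')$ (with $v\neq v'$) adjacent in $H$. A ($k$-fold) correspondence $L$-packing of $H$ is a collection of $k$ mutually disjoint correspondence $L$-colourings. The correspondence packing number $\chi^\star_c(G)$ is the least $k$ such that every $k$-fold correspondence-cover $H$ of $G$ via any $L$ admits a $k$-fold correspondence $L$-packing. *)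

(* Defs.v *)
From mathcomp Require Import all_boot.

Set Implicit Arguments.
Unset Strict Implicit.
Unset Printing Implicit Defensive.

Record sgraph := SGraph {
  vertex :> finType;
  adj : rel vertex;
  adj_sym : symmetric adj;
  adj_irrefl : irreflexive adj }.

Arguments adj {_} _ _.

Definition independent (G : sgraph) (A : {set G}) : Prop :=
  forall x y : G, x \in A -> y \in A -> ~~ adj x y.

Definition bipartite (G : sgraph) : Prop :=
  exists A : {set G}, independent A /\ independent (~: A).

Definition max_degree (G : sgraph) : nat :=
  \max_(v : G) #|[set w | adj v w]|.

(** Edges are represented by their sets of endpoints, so that a set of edges is
    a matching exactly when it is a [trivIset]. *)
Definition edges_between (H : sgraph) (A B : {set H}) : {set {set H}} :=
  [set [set x; y] | x in A, y in B & adj x y].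

Definition matching (H : sgraph) (M : {set {set H}}) : Prop := trivIset M.

(** Edges of [H] inside a single [L v] are not constrained. *)
Record corr_cover (G H : sgraph) (L : G -> {set H}) (k : nat) : Prop :=
  CorrCover {
    corr_cover_disjoint : forall v v' : G, v != v' -> [disjoint L v & L v'];
    corr_cover_full : \bigcup_(v : G) L v = [set: H];
    corr_cover_card : forall v : G, #|L v| = k;
    corr_cover_matching : forall v v' : G,
      adj v v' -> matching (edges_between (L v) (L v'));
    corr_cover_nonadj : forall v v' : G,
      v != v' -> ~~ adj v v' -> edges_between (L v) (L v') = set0 }.

Definition corr_colouring (G H : sgraph) (L : G -> {set H}) (S : {set H}) :
    Prop :=
  (forall v : G, #|S :&: L v| = 1) /\
  (forall (v v' : G) (x y : H), v != v' ->
     x \in S :&: L v -> y \in S :&: L v' -> ~~ adj x y).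

Definition corr_packing (G H : sgraph) (L : G -> {set H}) (k : nat)
    (P : 'I_k -> {set H}) : Prop :=
  (forall i : 'I_k, corr_colouring L (P i)) /\
  (forall i j : 'I_k, i != j -> [disjoint P i & P j]).

Definition corr_packable (G : sgraph) (k : nat) : Prop :=
  forall (H : sgraph) (L : G -> {set H}),
    corr_cover L k -> exists P : 'I_k -> {set H}, corr_packing L P.

(** [k] is the correspondence packing number of [G].  The least [k] is taken
    among positive integers: [corr_packable G 0] always holds, by the empty
    packing. *)
Definition is_corr_packing_number (G : sgraph) (k : nat) : Prop :=
  [/\ 0 < k, corr_packable G k
    & forall j : nat, 0 < j -> corr_packable G j -> k <= j].

(* Main.v *)
Require Import Defs.
From mathcomp Require Import all_boot all_order all_algebra.
From mathcomp Require Import fingroup perm.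
From mathcomp Require Import boolp reals sequences exp.
From mathcomp Require Import ring lra zify.
Set Implicit Arguments.
Unset Strict Implicit.
Unset Printing Implicit Defensive.
Import Order.TTheory GRing.Theory Num.Theory.

(** Let [A] and [~: A] be the two sides of the bipartite graph [G], let [D]
    bound its degrees and let [k] be about [(1 + eps) * D / ln D].  Give each
    vertex [a] of [A] a uniformly random bijection between its list and the [k]
    colourings, independently of the others.  No two vertices of [A] are
    adjacent, so these choices never conflict, and the packing extends to all
    of [G] once each vertex [b] outside [A] has a bijection of its own which
    avoids its neighbours: these extensions do not interact.

    Fix such a [b].  A cell [(x, i)], with [x] in the list of [b] and [i] a
    colouring, is covered when some neighbour of [b] uses in the colouring [i]
    the partner of [x].  What is wanted is a perfect matching of the uncovered
    cells.  One cell stays uncovered with probability about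
    [(1 - 1/k)^D = D^(- 1/(1 + eps))], hence each [x] has about a positive power
    of [D] uncovered cells.  By Hall's theorem, when there is no perfect
    matching then a rectangle of cells [S * ~: U], or the transpose of one, is
    covered; one can take [U] of size at most [k/2] and [S] of size about
    [#|U| / M] for a large constant [M] ([sparse_obstruction]).

    The lemma behind everything is that a rectangle with few rows is covered
    with probability at most that of independent cells ([cover_count]).  This
    is an induction on the number of permutations thrown in, and its step is
    about a single random permutation: the values on few points are almost
    uniform, even when the other ones among these points are known
    ([perm_moment]).  The indicators of the cells of a permutation are not
    negatively correlated (two cells in different rows and columns attract each
    other), and this is why the rectangle is shrunk to few rows: then the price
    is just to replace [1/k] by [1/(k - m)] with [m] a small fraction of [k].
    The shrinking also keeps the number of rectangles [(S, U)] below
    [k^((M + 1) #|S|)], which the union bound of [obstruction_count] can afford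
    as the expected number of uncovered cells per row beats any multiple of
    [ln k].

    The failure of [b] thus has probability far below [1 / (4 * D^2)], and it
    depends only on the neighbours of [b]; at most [D^2] failures share
    one of them, and the local lemma ([local_lemma]) avoids all failures at
    once. *)

(** * Hall's marriage theorem *)

Definition neighbours (T : finType) (r : rel T) (S : {set T}) : {set T} :=
  [set y | [exists x in S, r x y]].

(** The Halmos-Vaughan induction: a nonempty proper subset with just enough
    neighbours splits the problem in two; if there is none, any edge can be used
    to match one point, as the other sets lose at most the one spare neighbour
    they have. *)
Lemma hall_on (T : finType) (n : nat) (A : {set T}) (r : rel T) :
  #|A| <= n ->
  (forall S : {set T}, S \subset A -> #|S| <= #|neighbours r S|) ->
  exists f : T -> T, {in A &, injective f} /\ {in A, forall x, r x (f x)}.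
Proof.
elim: n A r => [|n IH] A r.
  rewrite leqn0 cards_eq0 => /eqP-> _.
  by exists id; split=> [x y|x]; rewrite inE.
have [->|[a aA]] := set_0Vmem A => cardA hallA.
  by exists id; split=> [x y|x]; rewrite inE.
pose tight (S : {set T}) := [&& S \proper A, S != set0 & #|neighbours r S| <= #|S|].
have [S /and3P[ltSA S0 leNS]|loose] := pickP tight.
  have sSA := proper_sub ltSA.
  have [|S' sS'|f [f_inj fr]] := IH S r.
  - by rewrite -ltnS (leq_trans (proper_card ltSA)).
  - exact: hallA (subset_trans sS' sSA).
  pose r' x y := r x y && (y \notin neighbours r S).
  have [||g [g_inj gr]] := IH (A :\: S) r'.
  - have := cardsID S A; rewrite (setIidPr sSA).
    move: S0; rewrite -card_gt0; move: cardA; lia.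
  - move=> S' sS'.
    have dSS' : #|S :|: S'| = #|S| + #|S'|.
      apply/eqP; rewrite (leq_card_setU S S').2 disjoint_sym.
      by rewrite disjoints_subset (subset_trans sS') // setDE subsetIr.
    have : #|neighbours r (S :|: S')| <= #|neighbours r S| + #|neighbours r' S'|.
      apply: leq_trans (leq_card_setU _ _).
      apply/subset_leq_card/subsetP => y.
      rewrite !inE => /existsP[x /andP[]].
      case: (boolP [exists x0 in S, r x0 y]) => //= yNS.
      rewrite inE => /orP[xS rxy|xS' rxy].
        by case/negP: yNS; apply/existsP; exists x; rewrite xS.
      by apply/existsP; exists x; rewrite /r' xS' rxy inE yNS.
    have : S :|: S' \subset A.
      by rewrite subUset sSA (subset_trans sS') // subsetDl.
    move/hallA; rewrite dSS'; move: leNS; lia.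
  have gN x : x \in A -> x \notin S -> g x \notin neighbours r S.
    by move=> xA xS; have /andP[] : r' x (g x) by apply: gr; rewrite inE xS.
  have fN x : x \in S -> f x \in neighbours r S.
    by move=> xS; rewrite inE; apply/existsP; exists x; rewrite xS fr.
  exists (fun x => if x \in S then f x else g x); split=> [x y xA yA|x xA] /=.
    case: ifPn => xS; case: ifPn => yS; first exact: f_inj.
    - by move=> efg; have := gN y yA yS; rewrite -efg fN.
    - by move=> efg; have := gN x xA xS; rewrite efg fN.
    - by apply: g_inj; rewrite inE ?xS ?yS.
  case: ifPn => xS; first exact: fr.
  by have /andP[] : r' x (g x) by apply: gr; rewrite inE xS.
have [y ray] : exists y, r a y.
  have := hallA [set a]; rewrite sub1set aA cards1 => /(_ isT).
  case/card_gt0P=> y; rewrite inE => /existsP[x /andP[/set1P-> ray]].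
  by exists y.
pose r' x z := r x z && (z != y).
have [||f [f_inj fr]] := IH (A :\ a) r'.
- by move: cardA; rewrite (cardsD1 a) aA.
- move=> S' sS'; have [->|S'0] := eqVneq S' set0; first by rewrite cards0.
  have := loose S'; rewrite /tight S'0 /= andbC properE.
  rewrite (subset_trans sS' (subsetDl _ _)) /=.
  have -> : ~~ (A \subset S').
    apply/negP=> /subsetP/(_ a aA)/(subsetP sS').
    by rewrite !inE eqxx.
  rewrite andbT => /negbT; rewrite -ltnNge => lt.
  have : #|neighbours r S'| <= 1 + #|neighbours r' S'|.
    rewrite -(cards1 y); apply: leq_trans (leq_card_setU _ _).
    apply/subset_leq_card/subsetP => z.
    rewrite !inE => /existsP[x /andP[xS' rxz]].
    case: eqVneq => //= zy; apply/existsP; exists x.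
    by rewrite xS' /r' rxz.
  lia.
exists (fun x => if x == a then y else f x).
have fN x : x \in A -> x != a -> f x != y.
  by move=> xA xa; have /andP[] : r' x (f x) by apply: fr; rewrite !inE xa.
split=> [x z xA zA|x xA] /=.
  case: eqVneq => [->|xa]; case: eqVneq => [->|za] //.
  - by move=> eyf; have := fN z zA za; rewrite -eyf eqxx.
  - by move=> eyf; have := fN x xA xa; rewrite eyf eqxx.
  - by apply: f_inj; rewrite !inE ?xa ?za.
case: eqVneq => [->//|xa].
by have /andP[] : r' x (f x) by apply: fr; rewrite !inE xa.
Qed.

(** * Random permutations *)

Local Open Scope ring_scope.

(** Precomposing with the transposition of [x] and [y], for [y] outside [J],
    preserves [w] and exchanges the events [s x = i] and [s y = i].  So these
    [#|T| - #|J|] disjoint events have the same weight.  With [w] the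
    indicator of an event about the values on [J], this says that the
    probability of [s x = i] given that event is at most [1 / (#|T| - #|J|)]. *)
Lemma perm_value_weight (R : realFieldType) (T : finType) (J : {set T})
    (w : {perm T} -> R) (x i : T) :
  (forall s, 0 <= w s) -> x \notin J ->
  (forall (y : T) (s : {perm T}), y \notin J -> w (tperm x y * s)%g = w s) ->
  (#|T| - #|J|)%:R * (\sum_(s : {perm T} | s x == i) w s) <= \sum_s w s.
Proof.
move=> w0 xJ wJ.
have shift y : y \notin J ->
    \sum_(s : {perm T} | s x == i) w s = \sum_(s : {perm T} | s y == i) w s.
  move=> yJ; rewrite [RHS](reindex_inj (mulgI (tperm x y))) /=.
  by apply: eq_big => [s|s _]; rewrite ?wJ // permM tpermR.
have -> : (#|T| - #|J|)%N = #|~: J| by rewrite [RHS]cardsCs setCK.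
rewrite mulr_natl -sumr_const.
rewrite (eq_bigr (fun y => \sum_(s : {perm T} | s y == i) w s)); last first.
  by move=> y; rewrite inE; apply: shift.
rewrite (exchange_big_dep xpredT) //=.
apply: ler_sum => s _; rewrite sumr_const -[leRHS]mulr1n.
apply: ler_wpMn2l => //.
rewrite -(cards1 ((s^-1)%g i)); apply/subset_leq_card/subsetP => y.
by rewrite !inE => /andP[_ /eqP <-]; rewrite permK.
Qed.

(** The points of [S] are removed one at a time: given the values on the others,
    at most [m] of them, each value of [s x] has conditional probability at
    most [1 / (#|T| - m)].  Splitting the factor as [al x + be x (s x)] matters:
    only the varying part is charged for this inexact bound, the constant part
    costs nothing. *)
Lemma perm_moment (R : realFieldType) (T : finType) (m : nat) (S : {set T})
    (al : T -> R) (be : T -> T -> R) :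
  (forall x, 0 <= al x) -> (forall x i, 0 <= be x i) ->
  (#|S| <= m.+1)%N -> (m < #|T|)%N ->
  \sum_(s : {perm T}) \prod_(x in S) (al x + be x (s x))
    <= (\prod_(x in S) (al x + (\sum_i be x i) / (#|T| - m)%:R))
       * #|{perm T}|%:R.
Proof.
move=> al0 be0.
elim: {S}_.+1 {-2}S (ltnSn #|S|) => // n IH S ltSn leSm ltm.
have [->|[x xS]] := set_0Vmem S.
  rewrite big_set0 mul1r (eq_bigr (fun=> 1)) => [|s _]; last by rewrite big_set0.
  by rewrite sumr_const.
have cS : #|S| = (#|S :\ x|).+1 by rewrite (cardsD1 x) xS.
pose G (s : {perm T}) := \prod_(y in S :\ x) (al y + be y (s y)).
have G0 s : 0 <= G s by apply: prodr_ge0 => y _; rewrite addr_ge0.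
have GJ (y : T) (s : {perm T}) : y \notin S :\ x -> G (tperm x y * s)%g = G s.
  move=> yS; apply: eq_bigr => z zS; rewrite permM tpermD //.
    by move: zS; rewrite !inE eq_sym => /andP[].
  by apply: contraNneq yS => ->.
have K0 : 0 < (#|T| - m)%:R :> R by rewrite ltr0n subn_gt0.
have wgt i : \sum_(s : {perm T} | s x == i) G s
    <= (\sum_s G s) / (#|T| - m)%:R.
  rewrite ler_pdivlMr // mulrC.
  apply: le_trans (perm_value_weight i G0 _ GJ); last by rewrite !inE eqxx.
  apply: ler_wpM2r; first exact: sumr_ge0.
  rewrite ler_nat; lia.
rewrite (big_setD1 x) //=.
rewrite (eq_bigr (fun s : {perm T} => al x * G s + be x (s x) * G s)); last first.
  by move=> s _; rewrite (big_setD1 x) //= mulrDl.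
rewrite big_split /= -mulr_sumr.
have -> : \sum_(s : {perm T}) be x (s x) * G s =
    \sum_i be x i * \sum_(s : {perm T} | s x == i) G s.
  rewrite (partition_big (fun s : {perm T} => s x) xpredT) //=.
  apply: eq_bigr => i _; rewrite mulr_sumr.
  by apply: eq_bigr => s /eqP->.
rewrite -mulrA.
apply: le_trans (_ : (al x + (\sum_i be x i) / (#|T| - m)%:R) * (\sum_s G s) <= _); last first.
  apply: ler_wpM2l.
    by rewrite addr_ge0 // divr_ge0 ?ler0n // sumr_ge0.
  by apply: IH => //; lia.
rewrite mulrDl lerD2l -mulrA mulr_suml.
apply: ler_sum => i _; apply: ler_wpM2l => //.
by rewrite mulrC.
Qed.

(** These are the first two terms of the binomial expansion of the right-hand
    side. *)
Lemma binomial_two_terms (R : realFieldType) (a b : R) (n : nat) :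
  0 <= a -> 0 <= b -> a ^+ n + n%:R * b * a ^+ n.-1 <= (a + b) ^+ n.
Proof.
move=> a0 b0; elim: n => [|n IH]; first by rewrite !expr0 !mul0r addr0.
rewrite [leRHS]exprSr; apply: le_trans (ler_wpM2r (addr_ge0 a0 b0) IH).
rewrite mulrDl mulrDr /= -exprSr -addrA lerD2l mulrDr.
case: n {IH} => [|n] /=; first by rewrite !expr0 !mulr0n; lra.
have -> : (n.+2)%:R = n.+1%:R + 1 :> R by rewrite -natr1.
have := mulr_ge0 (mulr_ge0 (mulr_ge0 (ler0n R n.+1) b0) (exprn_ge0 n a0)) b0.
rewrite exprS; lra.
Qed.

(** Resampling one coordinate of a uniformly random function leaves it uniform;
    this isolates one coordinate of a product space. *)
Lemma sum_ffun_resample (R : realFieldType) (V X : finType) (a : V)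
    (F : {ffun V -> X} -> R) :
  \sum_(w : {ffun V -> X}) \sum_(p : X)
     F [ffun v => if v == a then p else w v] = #|X|%:R * \sum_w F w.
Proof.
rewrite pair_big /= mulr_natl -sumr_const exchange_big /= pair_big /=.
pose swap (u : {ffun V -> X} * X) :=
  ([ffun v => if v == a then u.2 else u.1 v], u.1 a).
have swapK : involutive swap.
  move=> [w p]; congr pair; rewrite /swap /= ?ffunE ?eqxx //.
  by apply/ffunP => v; rewrite !ffunE; case: eqVneq => // ->; rewrite ?eqxx.
rewrite [RHS](reindex_inj (inv_inj swapK)) /=.
by apply: eq_bigr => -[w p].
Qed.

(** With [g n = 1 - (1 - q) ^+ n], the probability that a given cell is covered
    by [n] permutations of hitting probability [q], the bound is the one for
    independent cells.  In the induction, one more permutation [p] removes from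
    each row [Q x] the cell [p x] and the others have to cover what is left.
    This is why the cells to be covered form an arbitrary family of rows
    rather than a rectangle.  By [perm_moment], the average over [p] of the
    product of the [g n ^+ #|Q x :\ p x|] is at most the product of
    the [g n ^+ #|Q x| + #|Q x| * q * (g n ^+ (#|Q x| - 1) - g n ^+ #|Q x|)],
    which are the first two terms in the expansion of
    [(g n + q * (1 - g n)) ^+ #|Q x| = g (n + 1) ^+ #|Q x|]. *)
Lemma cover_count (R : realFieldType) (V T : finType) (m : nat) (S : {set T})
    (D : seq V) (Q : T -> {set T}) (q : R) :
  q = (#|T| - m)%:R^-1 -> (#|S| <= m.+1)%N -> (m < #|T|)%N -> uniq D ->
  #|[set w : {ffun V -> {perm T}} |
      [forall x in S, forall i in Q x, has (fun a => w a x == i) D]]|%:R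
   <= (\prod_(x in S) (1 - (1 - q) ^+ size D) ^+ #|Q x|)
      * #|{ffun V -> {perm T}}|%:R.
Proof.
move=> qE leSm ltm.
have q0 : 0 <= q by rewrite qE invr_ge0 ler0n.
have q1 : q <= 1.
  by rewrite qE invf_le1 ?ltr0n ?subn_gt0 // ler1n subn_gt0.
pose g n : R := 1 - (1 - q) ^+ n.
have g0 n : 0 <= g n.
  by rewrite subr_ge0 exprn_ile1 ?subr_ge0 // gerBl.
have g1 n : g n <= 1 by rewrite gerBl exprn_ge0 // subr_ge0.
elim: D Q => [|a D IH] Q /=.
  move=> _; rewrite subrr.
  have [Q0|] := boolP [forall x in S, Q x == set0].
    rewrite big1 ?mul1r ?ler_nat ?max_card // => x xS.
    by move/forall_inP: Q0 => /(_ x xS)/eqP->; rewrite cards0.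
  rewrite negb_forall_in => /exists_inP[x xS /set0Pn[i iQ]].
  rewrite [X in X%:R <= _](_ : _ = 0%N).
    by rewrite mulr_ge0 ?ler0n // prodr_ge0 // => y _; apply: exprn_ge0.
  apply/eqP; rewrite cards_eq0; apply/eqP/setP => w; rewrite !inE.
  apply/negP => /forall_inP/(_ x xS).
  by move=> /forall_inP/(_ i iQ).
move=> /andP[aD uD].
pose cov (D : seq V) (Q : T -> {set T}) (w : {ffun V -> {perm T}}) :=
  [forall x in S, forall i in Q x, has (fun a => w a x == i) D].
have covE D' Q' : #|[set w | cov D' Q' w]|%:R = \sum_w (cov D' Q' w)%:R :> R.
  rewrite -sum1_card natr_sum big_mkcond /=.
  by apply: eq_bigr => w _; rewrite inE; case: (cov D' Q' w).
have le_b2n (b c : bool) : b ==> c -> b%:R <= c%:R :> R.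
  by case: b c => -[] //= _; apply: ler01.
rewrite -/(cov (a :: D) Q) covE.
have P0 : 0 < #|{perm T}|%:R :> R by rewrite ltr0n; apply/card_gt0P; exists 1%g.
rewrite -(ler_pM2l P0) -(sum_ffun_resample a) exchange_big /=.
apply: le_trans (_ : \sum_(p : {perm T}) \prod_(x in S)
    g (size D) ^+ #|Q x :\ p x| * #|{ffun V -> {perm T}}|%:R <= _).
  apply: ler_sum => p _.
  apply: le_trans (IH (fun x => Q x :\ p x) uD).
  rewrite -/(cov D _) covE; apply: ler_sum => w _.
  apply: le_b2n; apply/implyP => /forall_inP cv.
  apply/forall_inP => x xS; apply/forall_inP => i.
  rewrite !inE => /andP[ip iQ].
  move/forall_inP: (cv x xS) => /(_ i iQ) /=; rewrite ffunE eqxx eq_sym (negbTE ip) /=.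
  case/hasP => b bD; rewrite ffunE; case: (eqVneq b a) => [ba|_ wb].
    by rewrite -ba bD in aD.
  by apply/hasP; exists b.
rewrite -mulr_suml mulrA; apply: ler_wpM2r; first exact: ler0n.
pose al x : R := g (size D) ^+ #|Q x|.
pose be x i : R :=
  if i \in Q x then g (size D) ^+ #|Q x|.-1 - g (size D) ^+ #|Q x| else 0.
have al0 x : 0 <= al x by rewrite exprn_ge0.
have be0 x i : 0 <= be x i.
  rewrite /be; case: ifP => // _; rewrite subr_ge0.
  by rewrite ler_wiXn2l // leq_pred.
have alE (p : {perm T}) x : g (size D) ^+ #|Q x :\ p x| = al x + be x (p x).
  rewrite /al /be (cardsD1 (p x) (Q x)); case: (p x \in Q x); last by rewrite addr0.
  by rewrite /= addrC subrK.
rewrite (eq_bigr (fun p : {perm T} => \prod_(x in S) (al x + be x (p x)))); last first.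
  by move=> p _; apply: eq_bigr => x _; apply: alE.
rewrite [leRHS]mulrC; apply: le_trans (perm_moment al0 be0 leSm ltm) _.
apply: ler_wpM2r; first exact: ler0n.
apply: ler_prod => x xS.
rewrite addr_ge0 ?divr_ge0 ?ler0n ?sumr_ge0 //=.
rewrite -big_mkcond sumr_const -qE.
have -> : 1 - (1 - q) ^+ (size D).+1 = g (size D) + q * (1 - g (size D)).
  by rewrite /g exprS; ring.
have qg0 : 0 <= q * (1 - g (size D)) by rewrite mulr_ge0 // subr_ge0.
apply: le_trans (binomial_two_terms #|Q x| (g0 _) qg0).
rewrite /al lerD2l.
case: #|Q x| => [|n] /=; first by rewrite !mulr0n !mul0r.
by rewrite -[X in X * q]mulr_natl exprS; lra.
Qed.

Local Close Scope ring_scope.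

(** * Obstructions to a perfect matching of uncovered cells *)

Lemma hall_perm (T : finType) (r : rel T) :
  (forall t : {perm T}, ~ forall x, r x (t x)) ->
  exists S : {set T}, #|neighbours r S| < #|S|.
Proof.
move=> no_perm; case: (pickP [pred S | #|neighbours r S| < #|S|]) => [S ltS|none].
  by exists S.
have [|f [f_inj fr]] := @hall_on T #|T| setT r (max_card _).
  by move=> S _; rewrite leqNgt; apply: negbT; apply: none.
have f_inj' : injective f by move=> x y; apply: f_inj; rewrite inE.
by case: (no_perm (perm f_inj')) => x; rewrite permE fr ?inE.
Qed.

Lemma subset_of_card (T : finType) (n : nat) (A : {set T}) :
  n <= #|A| -> exists2 B : {set T}, B \subset A & #|B| = n.
Proof.
case/card_geqP => s [s_uniq <- sA]; exists [set x in s].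
  by apply/subsetP => x; rewrite inE; apply: sA.
by rewrite cardsE; apply/card_uniqP.
Qed.

(** Given the pair [(U, S)], the rectangle to be covered is [S * ~: U].  Having
    [#|U| <= M * #|S|] bounds the number of such pairs by a power of [k^#|S|],
    having [S] of size at most [k / (2 * M) + 1] lets [cover_count] apply, and
    each row has at least [k / 2] cells. *)
Definition sparse_shape (T : finType) (M : nat) (p : {set T} * {set T}) : bool :=
  (#|p.1|.*2 <= #|T|) && (#|p.2| == (#|p.1| %/ M).+1).

(** A set [S] with fewer neighbours than elements is an obstruction with [U] its
    set of neighbours if [U] is small; otherwise the complements of [U] and [S]
    form an obstruction on the other side, and the complement of [S] is small.
    The rows are then thinned out to the required number. *)
Lemma sparse_obstruction (T : finType) (M : nat) (r : rel T) :
  (forall t : {perm T}, ~ forall x, r x (t x)) ->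
  exists2 p : {set T} * {set T}, sparse_shape M p &
    (forall x i, x \in p.2 -> i \notin p.1 -> ~~ r x i) \/
    (forall x i, x \in p.2 -> i \notin p.1 -> ~~ r i x).
Proof.
case/hall_perm => S ltUS.
have rU x i : x \in S -> i \notin neighbours r S -> ~~ r x i.
  by move=> xS; apply: contraNN => rxi; rewrite inE; apply/existsP; exists x; rewrite xS.
move: (neighbours r S) ltUS rU => U ltUS rU.
have cS := cardsC S; have cU := cardsC U.
have [leU|gtU] := leqP #|U|.*2 #|T|.
  have [|B sBS cB] := @subset_of_card _ (#|U| %/ M).+1 S.
    by apply: leq_ltn_trans ltUS; apply: leq_div.
  exists (U, B); first by rewrite /sparse_shape leU cB eqxx.
  by left=> x i xB; apply: rU; apply: (subsetP sBS).
have [|B sBU cB] := @subset_of_card _ (#|~: S| %/ M).+1 (~: U).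
  apply: leq_ltn_trans (leq_div _ _) _; lia.
have leS : #|~: S|.*2 <= #|T| by lia.
exists (~: S, B); first by rewrite /sparse_shape leS cB eqxx.
right=> x i /(subsetP sBU); rewrite !inE negbK => xU iS; exact: rU.
Qed.

Lemma card_exists (I W : finType) (P : I -> pred W) :
  #|[set w | [exists j, P j w]]| <= \sum_j #|[set w | P j w]|.
Proof.
rewrite -sum1_card big_mkcond /=.
rewrite (eq_bigr (fun j => \sum_w (P j w : nat))); last first.
  move=> j _; rewrite -sum1_card big_mkcond; apply: eq_bigr => w _.
  by rewrite inE; case: (P j w).
rewrite exchange_big; apply: leq_sum => w _; rewrite inE.
case: existsP => [[j Pj]|//]; by rewrite (bigD1 j) //= Pj.
Qed.

Lemma bin_le_exp (n m : nat) : 'C(n, m) <= n ^ m.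
Proof.
apply: leq_trans (_ : n ^_ m <= _); first by rewrite -bin_ffact leq_pmulr ?fact_gt0.
elim: m => // m IH; rewrite ffactnSr expnSr; exact: leq_mul IH (leq_subr _ _).
Qed.

Local Open Scope ring_scope.

Lemma sum_sets_card_le (R : realFieldType) (T : finType) (n : nat) (c : R) :
  0 <= c -> \sum_(S : {set T} | #|S| == n) c <= (#|T| ^ n)%:R * c.
Proof.
move=> c0; rewrite (eq_bigl (fun S => S \in [set S : {set T} | #|S| == n])); last first.
  by move=> S; rewrite inE.
rewrite sumr_const card_draws -[leLHS]mulr_natl; apply: ler_wpM2r => //.
by rewrite ler_nat bin_le_exp.
Qed.

(** Union bound.  There are at most [k ^ #|U| * k ^ #|S|] pairs of given sizes,
    hence at most [(k ^ M.+1) ^ #|S|] of them, and each rectangle is covered with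
    probability at most [z ^ #|S|], a row costing [z].  As [k ^ M.+1 * z <= 1],
    each of the [k + 1] possible sizes of [U] contributes at most
    [k ^ M.+1 * z]. *)
Lemma obstruction_count (R : realFieldType) (V T : finType) (M : nat)
    (D : seq V) (z : R) :
  let q := (#|T| - #|T| %/ M.*2)%:R^-1 in
  (0 < M)%N -> (0 < #|T|)%N -> uniq D -> 0 <= z ->
  (forall n, (#|T| <= n.*2)%N -> (1 - (1 - q) ^+ size D) ^+ n <= z) ->
  #|T|%:R ^+ M.+1 * z <= 1 ->
  #|[set w : {ffun V -> {perm T}} |
      [exists p : {set T} * {set T}, sparse_shape M p &&
        [forall x in p.2, forall i in ~: p.1, has (fun a => w a x == i) D]]]|%:R
   <= #|T|.+1%:R * (#|T|%:R ^+ M.+1 * z) * #|{ffun V -> {perm T}}|%:R.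
Proof.
move=> q M0 T0 uD z0 gz zle.
set W := #|{ffun _}|%:R; set k := #|T|.
pose C (p : {set T} * {set T}) := [set w : {ffun V -> {perm T}} |
  [forall x in p.2, forall i in ~: p.1, has (fun a => w a x == i) D]].
have Cle p : sparse_shape M p -> #|C p|%:R <= z ^+ #|p.2| * W.
  case/andP => leU /eqP cS.
  have cU := cardsC p.1.
  have q0 : 0 <= q by rewrite invr_ge0 ler0n.
  have q1 : q <= 1.
    rewrite invf_le1 ?ltr0n ?ler1n ?subn_gt0 ltn_Pdiv //; lia.
  apply: le_trans (cover_count (m := (k %/ M.*2)%N) (fun=> ~: p.1) erefl _ _ uD) _.
  - rewrite cS ltnS -muln2 mulnC divnMA leq_div2r // leq_divRL //; lia.
  - rewrite ltn_Pdiv //; lia.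
  apply: ler_wpM2r; first exact: ler0n.
  rewrite prodr_const; apply: lerXn2r; rewrite ?nnegrE ?exprn_ge0 //.
    by rewrite subr_ge0 exprn_ile1 ?subr_ge0 // gerBl.
  by apply: gz; lia.
apply: le_trans (_ : \sum_(p | sparse_shape M p) z ^+ #|p.2| * W <= _).
  apply: le_trans (_ : (\sum_(p | sparse_shape M p) #|C p|)%:R <= _); last first.
    by rewrite natr_sum; apply: ler_sum.
  rewrite ler_nat; apply: leq_trans (card_exists _) _.
  rewrite [leqRHS]big_mkcond /=; apply: leq_sum => p _.
  by case: ifP => // _; rewrite leqn0 cards_eq0 -subset0; apply/subsetP => w; rewrite !inE.
rewrite -mulr_suml; apply: ler_wpM2r; first exact: ler0n.
apply: le_trans (_ : \sum_(U : {set T}) (k%:R * z) ^+ (#|U| %/ M).+1 <= _).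
  apply: le_trans (_ : \sum_(U : {set T})
    \sum_(S : {set T} | #|S| == (#|U| %/ M).+1) z ^+ (#|U| %/ M).+1 <= _).
    rewrite pair_big_dep /= [leLHS]big_mkcond [leRHS]big_mkcond /=.
    apply: ler_sum => -[U S] _; rewrite /sparse_shape /=.
    case: (_ <= _)%N => /=; last by case: ifP => // _; apply: exprn_ge0.
    by case: eqP => // ->.
  apply: ler_sum => U _; apply: le_trans (sum_sets_card_le _ _ _) _.
    exact: exprn_ge0.
  by rewrite exprMn natrX.
rewrite (partition_big (fun U : {set T} => inord #|U| : 'I_k.+1) xpredT) //=.
have -> : k.+1%:R * (k%:R ^+ M.+1 * z) = \sum_(u < k.+1) (k%:R ^+ M.+1 * z).
  by rewrite sumr_const card_ord mulr_natl.
apply: ler_sum => u _.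
rewrite (eq_bigl (fun U : {set T} => #|U| == u)); last first.
  move=> U; rewrite -val_eqE /= inordK // ltnS; exact: max_card.
rewrite (eq_bigr (fun=> (k%:R * z) ^+ (u %/ M).+1)); last by move=> U /eqP->.
apply: le_trans (sum_sets_card_le _ _ _) _.
  by rewrite exprn_ge0 // mulr_ge0.
rewrite natrX exprMn mulrA -exprD.
apply: le_trans (_ : (k%:R ^+ M.+1 * z) ^+ (u %/ M).+1 <= _); last first.
  rewrite exprS ler_piMr ?mulr_ge0 ?exprn_ge0 // exprn_ile1 //.
  by rewrite mulr_ge0 ?exprn_ge0.
rewrite exprMn -exprM; apply: ler_wpM2r; first exact: exprn_ge0.
apply: ler_weXn2l; first by rewrite ler1n.
rewrite mulSn addnC leq_add2l mulnC; exact: ltnW (ltn_ceil _ _).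
Qed.

Local Close Scope ring_scope.

(** The perfect matching of the uncovered cells is a permutation [t], matching
    [x] with [t x]. *)
Definition no_free_perm (V T : finType) (D : seq V) : {set {ffun V -> {perm T}}} :=
  [set w : {ffun V -> {perm T}} |
    ~~ [exists t : {perm T}, [forall x, ~~ has (fun a => w a x == t x) D]]].

Local Open Scope ring_scope.
(** The transposed obstructions are as rare as the others, because inverting all
    permutations preserves the uniform distribution. *)
Lemma no_free_perm_count (R : realFieldType) (V T : finType) (M : nat)
    (D : seq V) (z : R) :
  let q := (#|T| - #|T| %/ M.*2)%:R^-1 in
  (0 < M)%N -> (0 < #|T|)%N -> uniq D -> 0 <= z ->
  (forall n, (#|T| <= n.*2)%N -> (1 - (1 - q) ^+ size D) ^+ n <= z) ->
  #|T|%:R ^+ M.+1 * z <= 1 ->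
  #|no_free_perm T D|%:R
   <= 2 * (#|T|.+1%:R * (#|T|%:R ^+ M.+1 * z)) * #|{ffun V -> {perm T}}|%:R.
Proof.
move=> q M0 T0 uD z0 gz zle.
have := obstruction_count M0 T0 uD z0 gz zle.
set bad := [set w | _] => badP.
pose inv (w : {ffun V -> {perm T}}) := [ffun a => (w a)^-1%g].
have invK : involutive inv by move=> w; apply/ffunP => a; rewrite !ffunE invgK.
apply: le_trans (_ : (#|bad| + #|bad|)%:R <= _); last by rewrite natrD; lra.
rewrite ler_nat; apply: leq_trans (_ : (#|bad| + #|inv @: bad| <= _)%N); last first.
  by rewrite leq_add2l leq_imset_card.
apply: leq_trans (leq_card_setU _ _); apply/subset_leq_card/subsetP => w.
rewrite inE => /existsPn no_perm.
have [t|p pM] := @sparse_obstruction _ M (fun x i => ~~ has (fun a => w a x == i) D).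
  by move=> wt; case/negP: (no_perm t); apply/forallP.
move=> covp; rewrite inE; apply/orP; case: covp => cov; [left|right].
  rewrite inE; apply/existsP; exists p; rewrite pM.
  apply/forall_inP => x xS; apply/forall_inP => i; rewrite inE => iU.
  exact/negPn/cov.
rewrite -(invK w); apply: imset_f; rewrite inE; apply/existsP; exists p; rewrite pM.
apply/forall_inP => x xS; apply/forall_inP => i; rewrite inE => iU.
have /negPn/hasP[a aD /eqP wa] := cov _ _ xS iU.
by apply/hasP; exists a; rewrite // ffunE -wa permK.
Qed.

Local Close Scope ring_scope.

(** * The local lemma *)

Definition depends_on (V X : finType) (A : {set V}) (E : {set {ffun V -> X}}) :=
  forall w w' : {ffun V -> X},
    (forall a, a \in A -> w a = w' a) -> (w \in E) = (w' \in E).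

(** Exchanging the coordinates in [A] of two points of the product space is an
    involution of its square which maps [E * F] onto [(E :&: F) * setT]. *)
Lemma independent_events (V X : finType) (A : {set V}) (E F : {set {ffun V -> X}}) :
  depends_on A E -> depends_on (~: A) F ->
  #|E :&: F| * #|{ffun V -> X}| = #|E| * #|F|.
Proof.
move=> depE depF.
pose mix (u v : {ffun V -> X}) := [ffun a => if a \in A then u a else v a].
pose swap (u : {ffun V -> X} * {ffun V -> X}) := (mix u.1 u.2, mix u.2 u.1).
have swapK : involutive swap.
  by move=> [u v]; congr pair; apply/ffunP => a; rewrite !ffunE; case: (a \in A).
rewrite -[#|{ffun _}|]cardsT -!cardsX.
rewrite -(card_imset _ (inv_inj swapK)) (can_imset_pre _ swapK).
apply: eq_card => -[u v]; rewrite !inE andbT /=; congr andb.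
  by apply: depE => a aA; rewrite ffunE aA.
by apply: depF => a; rewrite inE ffunE => /negbTE->.
Qed.

(** The probability of [E b], given that the events in [S] are avoided, is at
    most [1 / (2 * d)], by induction on [#|S|].  Let [nb] be the indices whose
    event may depend on [E b].  Avoiding [S :\: nb] is independent of [E b],
    so under this condition [E b] still has probability at most [1 / (4 * d)].
    By induction each of the at most [d] events in [S :&: nb] has probability at
    most [1 / (2 * d)] under the same condition, so that avoiding all of [S]
    keeps at least half of the weight. *)
Lemma local_lemma (V X I : finType) (N : I -> {set V})
    (E : I -> {set {ffun V -> X}}) (d : nat) :
  0 < d -> 0 < #|X| ->
  (forall b, depends_on (N b) (E b)) ->
  (forall b, #|[set c | ~~ [disjoint N b & N c]]| <= d) ->
  (forall b, 4 * d * #|E b| <= #|{ffun V -> X}|) ->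
  exists w, forall b, w \notin E b.
Proof.
move=> d0 X0 dep degd rare.
pose avoid (S : {set I}) := [set w | [forall b in S, w \notin E b]].
have Om0 : 0 < #|{ffun V -> X}| by rewrite card_ffun expn_gt0 X0.
have avoidS (S S' : {set I}) : S' \subset S -> avoid S \subset avoid S'.
  move=> sS; apply/subsetP => w; rewrite !inE => /forall_inP av.
  by apply/forall_inP => b /(subsetP sS)/av.
have cond n : forall (S : {set I}) b, #|S| <= n ->
    2 * d * #|E b :&: avoid S| <= #|avoid S|.
  elim: n => [|n IH] S b leSn.
    have -> : avoid S = setT.
      move: leSn; rewrite leqn0 cards_eq0 => /eqP->.
      by apply/setP => w; rewrite !inE; apply/forall_inP => c; rewrite inE.
    rewrite setIT cardsT; apply: leq_trans (rare b); nia.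
  pose nb := [set c | ~~ [disjoint N b & N c]].
  have indep : #|E b :&: avoid (S :\: nb)| * #|{ffun V -> X}|
      = #|E b| * #|avoid (S :\: nb)|.
    apply: (independent_events (dep b)) => w w' eqw; rewrite !inE.
    apply: eq_forallb_in => c; rewrite !inE negbK => /andP[dis cS].
    congr negb; apply: dep => a aNc; apply: eqw; rewrite inE.
    by move: dis; rewrite disjoint_sym => /disjointFr->.
  (* Conditioning on the rest of [S] loses at most a factor 2. *)
  have half : #|avoid (S :\: nb)| <= 2 * #|avoid S|.
    have [Snb0|Snb0] := posnP #|S :&: nb|.
      have -> : S :\: nb = S.
        apply/setP => c; rewrite inE; case: (boolP (c \in nb)) => //= cnb.
        have : c \notin S :&: nb.
          by rewrite (eqP (_ : S :&: nb == set0)) ?inE // -cards_eq0 Snb0.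
        by rewrite inE cnb andbT => /negbTE->.
      lia.
    have lem c : 2 * d * #|E c :&: avoid (S :\: nb)| <= #|avoid (S :\: nb)|.
      by apply: IH; have := cardsID nb S; lia.
    have sub : avoid (S :\: nb) \subset
        avoid S :|: \bigcup_(c in S :&: nb) (E c :&: avoid (S :\: nb)).
      apply/subsetP => w wav; rewrite inE.
      case: (boolP (w \in avoid S)) => //=.
      rewrite inE negb_forall_in => /exists_inP[c cS]; rewrite negbK => wc.
      have cnb : c \in nb.
        apply: contraLR wc => cnb; move: wav; rewrite inE => /forall_inP; apply.
        by rewrite inE cnb.
      by apply/bigcupP; exists c; rewrite inE ?cS // wc.
    have := leq_trans (subset_leq_card sub) (leq_card_setU _ _).1.
    have : #|\bigcup_(c in S :&: nb) (E c :&: avoid (S :\: nb))|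
        <= \sum_(c in S :&: nb) #|E c :&: avoid (S :\: nb)|.
      elim/big_rec2: _ => [|c m B _ leBm]; first by rewrite cards0.
      by apply: leq_trans (leq_card_setU _ _) _; rewrite leq_add2l.
    have : 2 * d * (\sum_(c in S :&: nb) #|E c :&: avoid (S :\: nb)|)
        <= d * #|avoid (S :\: nb)|.
      rewrite big_distrr /=; apply: (@leq_trans (\sum_(c in S :&: nb) #|avoid (S :\: nb)|)).
        by apply: leq_sum => c _; apply: lem.
      rewrite sum_nat_const leq_mul2r; apply/orP; right.
      apply: leq_trans (degd b); apply: subset_leq_card; exact: subsetIr.
    nia.
  have : #|E b :&: avoid S| <= #|E b :&: avoid (S :\: nb)|.
    by apply: subset_leq_card; apply: setIS; apply: avoidS; apply: subsetDl.
  have : 4 * d * #|E b :&: avoid (S :\: nb)| <= #|avoid (S :\: nb)|.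
    rewrite -(leq_pmul2r Om0) -mulnA indep mulnA mulnC leq_mul2l.
    by rewrite (rare b) orbT.
  nia.
have pos n : forall S : {set I}, #|S| <= n -> 0 < #|avoid S|.
  elim: n => [|n IH] S leSn.
    move: leSn; rewrite leqn0 cards_eq0 => /eqP->.
    rewrite (_ : avoid _ = setT) ?cardsT //.
    by apply/setP => w; rewrite !inE; apply/forall_inP => c; rewrite inE.
  have [->|[b bS]] := set_0Vmem S; first by apply: IH; rewrite cards0.
  have leS' : #|S :\ b| <= n by move: leSn; rewrite (cardsD1 b) bS.
  have := cond n (S :\ b) b leS'; have := IH _ leS'.
  have -> : avoid S = avoid (S :\ b) :\: E b.
    apply/setP => w; rewrite !inE; apply/forall_inP/andP => [av|[wb /forall_inP av] c cS].
      split; first exact: av.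
      by apply/forall_inP => c; rewrite inE => /andP[_ /av].
    by have [->//|cb] := eqVneq c b; apply: av; rewrite !inE cb.
  have := cardsID (E b) (avoid (S :\ b)); rewrite setIC; nia.
have /card_gt0P[w] := pos #|I| setT (max_card _).
by rewrite inE => /forall_inP av; exists w => b; apply: av.
Qed.

(** * From permutations to packings *)

(** Here [mu b a] sends each element of the list of [b] to its partner in the
    list of [a], and [w a], [t b] send the elements of a list to the colouring
    that uses them.  For fixed [b], composing each [w a] with the fixed
    permutation [mu b a] preserves the uniform distribution, so the partners
    can be forgotten when the failure of [b] is counted. *)
Lemma free_perms_exist (V T : finType) (N : V -> {set V}) (mu : V -> V -> {perm T})
    (d : nat) :
  0 < d ->
  (forall b, #|[set c | ~~ [disjoint N b & N c]]| <= d) ->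
  (forall b, 4 * d * #|no_free_perm T (enum (N b))| <= #|{ffun V -> {perm T}}|) ->
  exists (w t : V -> {perm T}), forall b a x, a \in N b -> w a (mu b a x) <> t b x.
Proof.
move=> d0 degd rare.
pose f b (w : {ffun V -> {perm T}}) := [ffun a => (mu b a * w a)%g].
have f_inj b : injective (f b).
  move=> w w' /ffunP eqf; apply/ffunP => a.
  by have := eqf a; rewrite !ffunE => /mulgI.
pose E b := [set w | f b w \in no_free_perm T (enum (N b))].
have [|b w w' eqw||b|w wE] := @local_lemma V {perm T} V N E d d0.
- by apply/card_gt0P; exists 1%g.
- rewrite !inE; congr negb; apply: eq_existsb => t; apply: eq_forallb => x.
  congr negb; apply: eq_in_has => a; rewrite mem_enum => aN.
  by rewrite !ffunE eqw.
- exact: degd.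
- apply: leq_trans (rare b); rewrite leq_mul2l; apply/orP; right.
  rewrite -(card_imset _ (f_inj b)); apply/subset_leq_card/subsetP => w.
  by case/imsetP => w'; rewrite inE => w'E ->.
have free b : exists t : {perm T}, forall a x, a \in N b -> w a (mu b a x) <> t x.
  have := wE b; rewrite !inE negbK => /existsP[t /forallP wt].
  exists t => a x aN wx; case/negP: (wt x); apply/hasP; exists a.
    by rewrite mem_enum.
  by rewrite ffunE permM wx.
have [t wt] := fin_all_exists free.
by exists w, t => b a x; apply: wt.
Qed.

(** Take a permutation which agrees with [r] at as many points as possible: if
    [r x y] but [t x <> y], then exchanging the values [t x] and [y] would
    improve it. *)
Lemma perm_extension (T : finType) (r : rel T) :
  (forall x y y', r x y -> r x y' -> y = y') ->
  (forall x x' y, r x y -> r x' y -> x = x') ->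
  exists t : {perm T}, forall x y, r x y -> t x = y.
Proof.
move=> rfun rinj.
pose agree (t : {perm T}) := [set x | r x (t x)].
pose t := [arg max_(t > (1%g : {perm T})) #|agree t|].
exists t => x y rxy; apply/eqP/negPn/negP => txy.
have maxt (t' : {perm T}) : #|agree t'| <= #|agree t|.
  by rewrite /t; case: arg_maxnP => // s _; apply.
have := maxt (t * tperm (t x) y)%g; rewrite leqNgt => /negP; apply.
apply: proper_card; rewrite properE; apply/andP; split.
  apply/subsetP => z; rewrite !inE permM => rz.
  have ztx : t x != t z.
    apply: contraNneq txy => /perm_inj zx; rewrite -zx in rz.
    by rewrite (rfun _ _ _ rxy rz).
  have zy : y != t z.
    apply: contraNneq txy => yz; rewrite -yz in rz.
    by rewrite (rinj _ _ _ rxy rz) -yz.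
  by rewrite tpermD.
apply/subsetPn; exists x; rewrite !inE ?permM ?tpermL //.
by apply: contra txy => rxt; rewrite (rfun _ _ _ rxt rxy).
Qed.

(** The edges from [x] to [y] and to [y'] meet, so they are the same edge of the
    matching. *)
Lemma corr_cover_partner (G H : sgraph) (L : G -> {set H}) (k : nat) (v v' : G)
    (x y y' : H) :
  corr_cover L k -> adj v v' -> x \in L v -> y \in L v' -> y' \in L v' ->
  adj x y -> adj x y' -> y = y'.
Proof.
move=> cov vv' xL yL y'L xy xy'.
have vNv' : v != v' by apply: contraTneq vv' => ->; rewrite adj_irrefl.
have dis := corr_cover_disjoint cov vNv'.
have edge z : z \in L v' -> adj x z -> [set x; z] \in edges_between (L v) (L v').
  by move=> zL xz; apply/imset2P; exists x z; rewrite // inE zL.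
apply/eqP; have [//|yNy'] := eqVneq y y'.
have /trivIsetP/(_ _ _ (edge _ yL xy) (edge _ y'L xy')) := corr_cover_matching cov vv'.
have : [set x; y] != [set x; y'].
  apply: contraNneq yNy' => /setP/(_ y); rewrite !inE eqxx orbT.
  case/esym/orP => [/eqP yx|//].
  by have := disjointFr dis xL; rewrite -yx yL.
move=> neq /(_ neq)/disjointFr/(_ (set21 x y)).
by rewrite set21.
Qed.

(** Such a [c] is a neighbour of a neighbour of [b]. *)
Lemma common_neighbours_card (G : sgraph) (D : nat) (b : G) :
  max_degree G <= D ->
  #|[set c : G | ~~ [disjoint [set w | adj b w] & [set w | adj c w]]]| <= D * D.
Proof.
move=> maxD.
have deg (v : G) : #|[set w | adj v w]| <= D.
  by apply: leq_trans maxD; apply: (@leq_bigmax _ (fun v : G => #|[set w | adj v w]|)).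
apply: (@leq_trans #|\bigcup_(a in [set w | adj b w]) [set w | adj a w]|).
  apply/subset_leq_card/subsetP => c; rewrite inE => /pred0Pn[a /andP[]].
  rewrite !inE => ba ca; apply/bigcupP; exists a; rewrite inE //.
  by rewrite adj_sym.
apply: (@leq_trans (\sum_(a in [set w | adj b w]) #|[set w | adj a w]|)).
  elim/big_rec2: _ => [|c m B _ leBm]; first by rewrite cards0.
  by apply: leq_trans (leq_card_setU _ _) _; rewrite leq_add2l.
apply: (@leq_trans (\sum_(a in [set w | adj b w]) D)).
  by apply: leq_sum.
by rewrite sum_nat_const leq_mul2r deg orbT.
Qed.

(** The colouring [i] takes from each list the element that the permutation of
    its vertex sends to [i]: disjointness of the colourings is then automatic,
    and the only possible conflicts are across the bipartition. *)
Lemma bipartite_corr_packable (G : sgraph) (D k : nat) :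
  0 < D -> bipartite G -> max_degree G <= D ->
  (forall s : seq G, uniq s -> size s <= D ->
     4 * (D * D) * #|no_free_perm 'I_k s| <= #|{ffun G -> {perm 'I_k}}|) ->
  corr_packable G k.
Proof.
move=> D0 [A [indA indB]] maxD rare H L cov.
pose e (v : G) (i : 'I_k) : H := enum_val (cast_ord (esym (corr_cover_card cov v)) i).
have eL v i : e v i \in L v by apply: enum_valP.
have e_inj v : injective (e v) by move=> i j /enum_val_inj/cast_ord_inj.
have mu_ex (b : G) : exists mu : G -> {perm 'I_k}, forall a x y,
    adj b a -> adj (e b x) (e a y) -> mu a x = y.
  suff /fin_all_exists[mu muP] : forall a, exists m : {perm 'I_k}, forall x y,
      adj b a -> adj (e b x) (e a y) -> m x = y by exists mu.
  move=> a; case: (boolP (adj b a)) => ba; last by exists 1%g.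
  have [x y y' xy xy'|x x' y xy x'y|mu mur] :=
    @perm_extension _ (fun x y => adj (e b x) (e a y)).
  - apply: (e_inj a); exact: (corr_cover_partner cov ba (eL _ _) (eL _ _) (eL _ _) xy).
  - apply: (e_inj b); rewrite adj_sym in xy; rewrite adj_sym in x'y.
    rewrite adj_sym in ba.
    exact: (corr_cover_partner cov ba (eL _ _) (eL _ _) (eL _ _) xy).
  by exists mu => x y _; apply: mur.
have [mu muP] := fin_all_exists mu_ex.
pose N (b : G) := [set a | adj b a].
have [|b|b|w [t free]] := @free_perms_exist G _ N mu (D * D).
- by rewrite muln_gt0 D0.
- exact: common_neighbours_card.
- apply: rare; first exact: enum_uniq.
  rewrite -cardE; apply: leq_trans maxD.
  exact: (@leq_bigmax _ (fun v : G => #|[set w | adj v w]|)).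
pose u v : {perm 'I_k} := if v \in A then w v else t v.
pose c v i := e v ((u v)^-1%g i).
have cL v i : c v i \in L v by apply: eL.
have c_list v v' x : x \in L v -> x \in L v' -> v = v'.
  move=> xv xv'; apply/eqP/negPn/negP => /(corr_cover_disjoint cov)/disjointFr/(_ xv).
  by rewrite xv'.
pose P i := [set c v i | v : G].
have PL i v : P i :&: L v = [set c v i].
  apply/setP => x; rewrite !inE; apply/andP/eqP => [[/imsetP[v' _ ->] xv]|->].
    by rewrite (c_list _ _ _ xv (cL v' i)).
  by split; first exact: imset_f.
have across b a i : a \in A -> b \notin A -> adj b a -> ~~ adj (c b i) (c a i).
  move=> aA bA ba; apply/negP => /(muP b a _ _ ba) mux.
  apply: (free b a ((t b)^-1%g i)); first by rewrite inE.
  by move: mux; rewrite /u aA (negbTE bA) => ->; rewrite !permKV.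
exists P; split=> [i|i j ij].
  split=> [v|v v' x y vv']; first by rewrite PL cards1.
  rewrite !PL => /set1P-> /set1P->.
  case: (boolP (adj v v')) => [adjv|nadj]; last first.
    apply/negP => xy; have /setP/(_ [set c v i; c v' i]) := corr_cover_nonadj cov vv' nadj.
    rewrite inE; move/negP; apply; apply/imset2P; exists (c v i) (c v' i) => //.
    by rewrite inE cL.
  case: (boolP (v \in A)) => vA; case: (boolP (v' \in A)) => v'A.
  - by case/negP: (indA v v' vA v'A).
  - by rewrite adj_sym across // adj_sym.
  - exact: across.
  - by have := indB v v'; rewrite !inE adjv => /(_ vA v'A).
rewrite -setI_eq0; apply/eqP/setP => x; rewrite !inE; apply/negP => /andP[].
case/imsetP => v _ -> /imsetP[v' _ eqc]; case/eqP: ij.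
have ev : v = v' by apply: (c_list _ _ (c v i)); rewrite // eqc.
by move: eqc; rewrite -ev => /e_inj/perm_inj.
Qed.

(** * Choice of the parameters *)

Local Open Scope ring_scope.

(** Since [1 - 1/K = 1 / (1 + 1/(K - 1)) >= expR (- 1/(K - 1))], the right-hand
    side is at least [expR (- D / (K - 1))], and [D / (K - 1)] is at most
    [L / (1 + eps / 2) <= L - eps * L / 3]. *)
Lemma survival_lower_bound (R : realType) (eps L K : R) (D : nat) :
  0 < eps -> eps <= 1 -> 0 < L -> D%:R = expR L ->
  (1 + eps / 2) * (expR L / L) <= K - 1 ->
  expR (eps * L / 3 - L) <= (1 - K^-1) ^+ D.
Proof.
move=> e0 e1 L0 DE leK.
have X0 : 0 < expR L / L by rewrite divr_gt0 // expR_gt0.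
have K1 : 0 < K - 1 by apply: lt_le_trans leK; rewrite mulr_gt0 //; lra.
have K0 : 0 < K by lra.
have -> : 1 - K^-1 = (1 + (K - 1)^-1)^-1.
  by field; rewrite !lt0r_neq0 //; lra.
apply: le_trans (_ : expR (- (K - 1)^-1) ^+ D <= _); last first.
  rewrite lerXn2r ?nnegrE ?expR_ge0 ?invr_ge0 ?addr_ge0 ?invr_ge0 ?(ltW K1) //.
  rewrite expRN lef_pV2 ?posrE ?expR_gt0 ?expR_ge1Dx //.
  by rewrite addr_gt0 ?invr_gt0.
rewrite -expRM_natr ler_expR mulNr lerNr opprB.
rewrite mulrC ler_pdivrMr // DE.
have -> : expR L = L * (expR L / L) by field; rewrite lt0r_neq0.
move: (expR L / L) X0 leK => X X0 leK.
apply: le_trans (_ : (L - eps * L / 3) * ((1 + eps / 2) * X) <= _); last first.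
  by apply: ler_wpM2l => //; nra.
have LX : 0 <= L * X by rewrite ltW // mulr_gt0.
have -> : (L - eps * L / 3) * ((1 + eps / 2) * X)
    = L * X * (1 + (eps - eps ^+ 2) / 6) by field.
rewrite ler_peMr // lerDl divr_ge0 // expr2; nra.
Qed.

(** Take [k] the integer part of [(1 + eps) * X] with [X = D / L] and [L = ln D].
    For [M > 4 / eps] the loss [m = k %/ M.*2] is at most [eps * k / 8], so that
    [k - m - 1 >= (1 + eps / 2) * X] for large [X].  By [survival_lower_bound] the
    exponent is at least [expR (eps * L / 3) / (2 * L)], which is at least
    quadratic in [L], whereas the logarithm of the other factors is at most
    [(2 * M + 10) * L]. *)
Lemma parameter_choice (R : realType) (eps : R) :
  0 < eps -> eps <= 1 ->
  exists M D0 : nat, (0 < M)%N /\ forall D : nat, (D0 <= D)%N ->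
  exists k : nat, [/\ (0 < k)%N, (0 < D)%N,
    k%:R <= (1 + eps) * (D%:R / ln (D%:R : R)),
    0 <= 1 - (k - k %/ M.*2)%:R^-1 :> R &
    8 * D%:R ^+ 2 * k.+1%:R * k%:R ^+ M.+1
      * expR (- ((1 - (k - k %/ M.*2)%:R^-1) ^+ D * (k%:R / 2))) <= 1 :> R].
Proof.
move=> e0 e1.
pose M := (Num.truncn (4 / eps)).+1.
(* The three terms serve [L >= 1], [X >= 8 / eps] and the final comparison. *)
pose L0 : R := 1 + 16 / eps + 324 * (2 * M%:R + 10) / eps ^+ 3.
exists M, (Num.truncn (expR L0)).+1; split=> // D leD.
have D_gt : expR L0 < D%:R.
  by apply: lt_le_trans (truncnS_gt _) _; rewrite ler_nat.
have D0 : 0 < D%:R :> R by apply: lt_trans D_gt; apply: expR_gt0.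
have [L DE] : exists L, D%:R = expR L :> R by exists (ln D%:R); rewrite lnK.
have leL : L0 <= L by rewrite ltW // -ltr_expR -DE.
have -> : ln D%:R = L by rewrite DE expRK.
have ei0 : 0 < eps^-1 by rewrite invr_gt0.
have M0 : 0 <= M%:R :> R by apply: ler0n.
have t0 : 0 <= 324 * (2 * M%:R + 10) / eps ^+ 3.
  by rewrite divr_ge0 ?exprn_ge0 ?(ltW e0) //; lra.
have L1 : 1 <= L by move: leL; rewrite /L0; lra.
have L16 : 16 / eps <= L by move: leL; rewrite /L0; lra.
have L324 : 324 * (2 * M%:R + 10) / eps ^+ 3 <= L by move: leL; rewrite /L0; lra.
have L_gt0 : 0 < L by lra.
rewrite DE; set X := expR L / L.
have X0 : 0 < X by rewrite divr_gt0 // expR_gt0.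
have X8 : 8 / eps <= X.
  rewrite ler_pdivlMr //.
  have := expR_ge1Dxn 1 (ltW L_gt0); rewrite expr2 => exp2.
  apply: le_trans (_ : L * L / 2 <= _); first by nra.
  by apply: le_trans exp2; rewrite lerDr.
pose k := Num.truncn ((1 + eps) * X).
have /andP[lek gtk] : k%:R <= (1 + eps) * X < k.+1%:R.
  by apply: truncn_itv; rewrite mulr_ge0 ?(ltW X0) //; lra.
have eX : 8 <= eps * X by move: X8; rewrite ler_pdivrMr // mulrC.
rewrite -natr1 in gtk.
have kX : X <= k%:R by nra.
have k0 : (0 < k)%N by rewrite -(ltr0n R); lra.
pose m := (k %/ M.*2)%N.
have mk : (m <= k)%N by apply: leq_div.
have m8 : m%:R <= k%:R * eps / 8 :> R.
  have : (m * M.*2)%:R <= k%:R :> R by rewrite ler_nat leq_trunc_div.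
  have : 4 / eps < M%:R by apply: truncnS_gt.
  rewrite ltr_pdivrMr // -muln2 !natrM => M4 mM.
  have m0 : 0 <= m%:R :> R by apply: ler0n.
  nra.
have leK : (1 + eps / 2) * X <= (k - m)%:R - 1.
  rewrite natrB //; nra.
have K1 : 1 <= (k - m)%:R :> R by nra.
have q1 : (k - m)%:R^-1 <= 1 :> R by rewrite invf_le1 //; lra.
have q0 : 0 <= (k - m)%:R^-1 :> R by rewrite invr_ge0; lra.
exists k; split; rewrite -/m //.
- by rewrite -(ltr0n R).
- by rewrite subr_ge0.
have surv := survival_lower_bound e0 e1 L_gt0 DE leK.
have pk : (2 * M%:R + 10) * L <= (1 - (k - m)%:R^-1) ^+ D * (k%:R / 2).
  apply: le_trans (_ : expR (eps * L / 3 - L) * (X / 2) <= _); last first.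
    by apply: ler_pM => //; rewrite ?expR_ge0 ?divr_ge0 ?(ltW X0) //; lra.
  rewrite expRD expRN /X.
  have -> : expR (eps * L / 3) / expR L * (expR L / L / 2) = expR (eps * L / 3) / (2 * L).
    by field; rewrite !lt0r_neq0 // expR_gt0.
  rewrite ler_pdivlMr; last by lra.
  have eL : 0 <= eps * L / 3 by rewrite divr_ge0 // mulr_ge0 // ltW.
  have := expR_ge1Dxn 2 eL => exp3.
  apply: le_trans (_ : (eps * L / 3) ^+ 3 / 3`!%:R <= _); last first.
    by apply: le_trans exp3; rewrite lerDr.
  move: L324; rewrite ler_pdivrMr ?exprn_gt0 // => L324.
  have -> : (eps * L / 3) ^+ 3 / 3`!%:R = L ^+ 2 * 2 * (L * eps ^+ 3) / 324.
    by rewrite (_ : 3`! = 6)%N //; field.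
  rewrite ler_pdivlMr //.
  have -> : (2 * M%:R + 10) * L * (2 * L) * 324
      = L ^+ 2 * 2 * (324 * (2 * M%:R + 10)) by ring.
  by apply: ler_wpM2l => //; rewrite mulr_ge0 ?exprn_ge0 // ltW.
(* Each of [8], [D ^ 2], [k + 1] and [k] is at most a small power of [expR L]. *)
have E2 : 2 <= expR L by apply: le_trans (expR_ge1Dx L); lra.
have XE : X <= expR L by rewrite ler_pdivrMr // ler_peMr // expR_ge0.
have k2 : k%:R <= expR L ^+ 2.
  by rewrite expr2; nra.
have k3 : k.+1%:R <= expR L ^+ 3.
  rewrite -natr1 !exprS expr0 mulr1; nra.
have c3 : 8 <= expR L ^+ 3 by rewrite !exprS expr0 mulr1; nra.
rewrite expRN ler_pdivrMr ?expR_gt0 // mul1r.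
apply: le_trans (_ : expR ((2 * M%:R + 10) * L) <= _); last by rewrite ler_expR.
have -> : (2 * M%:R + 10) * L = (3 + 2 + 3 + 2 * M.+1)%:R * L.
  by rewrite !natrD natrM -natr1; ring.
rewrite expRM_natl 3!exprD [in leRHS](exprM _ 2).
have kM : k%:R ^+ M.+1 <= (expR L ^+ 2) ^+ M.+1.
  by apply: lerXn2r => //; rewrite nnegrE ?exprn_ge0 ?expR_ge0.
have L2_ge0 : 0 <= expR L ^+ 2 by rewrite exprn_ge0 // expR_ge0.
apply: ler_pM kM; rewrite ?exprn_ge0 //; first by rewrite mulr_ge0 // mulr_ge0.
apply: ler_pM k3 => //; first exact: mulr_ge0.
exact: ler_wpM2r.
Qed.

Local Close Scope ring_scope.

(** * The bound on the packing number *)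

Lemma least_nat (P : nat -> Prop) (n : nat) :
  P n -> exists m, [/\ P m, m <= n & forall j, P j -> m <= j].
Proof.
move=> Pn; have exP : exists m, `[< P m >] by exists n; apply/asboolP.
case: (ex_minnP exP) => m /asboolP Pm minm; exists m; split=> //.
  by apply: minm; apply/asboolP.
by move=> j Pj; apply: minm; apply/asboolP.
Qed.
Local Open Scope ring_scope.

Theorem theorem11 (R : realType) (eps : R) (eps_gt0 : 0 < eps) :
  exists Delta0 : nat, forall Delta : nat, (Delta0 <= Delta)%N ->
  forall G : sgraph, bipartite G -> (max_degree G <= Delta)%N ->
  exists k : nat, is_corr_packing_number G k /\
    k%:R <= (1 + eps) * (Delta%:R / ln (Delta%:R : R)).
Proof.
(* The parameters are chosen for [eps <= 1]; a smaller [eps] is harder. *)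
pose e := Num.min eps 1.
have e0 : 0 < e by rewrite lt_min eps_gt0 ltr01.
have e1 : e <= 1 by rewrite ge_min lexx orbT.
have [M [D0 [M0 choice]]] := parameter_choice e0 e1.
exists D0 => D /choice[k [k0 D_gt0 lek q1 small]] G bipG maxD.
suff pack : corr_packable G k.
  have [m [[m0 packm] lemk minm]] :=
    @least_nat (fun j => (0 < j)%N /\ corr_packable G j) k (conj k0 pack).
  exists m; split; first by split=> // j j0 packj; apply: minm.
  apply: le_trans (_ : k%:R <= _); first by rewrite ler_nat.
  apply: le_trans lek _; apply: ler_wpM2r; last by rewrite lerD2l ge_min lexx.
  by rewrite divr_ge0 ?ler0n // ln_ge0 // ler1n.
apply: (bipartite_corr_packable D_gt0 bipG maxD) => s s_uniq leD.
set q : R := (k - k %/ M.*2)%:R^-1 in q1 small.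
set p : R := (1 - q) ^+ D in small.
set z := expR _ in small.
have z0 : 0 <= z by apply: expR_ge0.
have kM0 : 0 <= k%:R ^+ M.+1 * z by rewrite mulr_ge0 // exprn_ge0.
have q0 : 0 <= q by rewrite invr_ge0.
have zle : k%:R ^+ M.+1 * z <= 1.
  apply: le_trans small; rewrite -[leRHS]mulrA; apply: ler_peMl => //.
  have : 1 <= D%:R ^+ 2 :> R by rewrite exprn_ege1 // ler1n.
  have : 1 <= k.+1%:R :> R by rewrite ler1n.
  nra.
have cover n : (k <= n.*2)%N -> (1 - (1 - q) ^+ size s) ^+ n <= z.
  move=> lekn.
  have pD : p <= (1 - q) ^+ size s by rewrite ler_wiXn2l // gerBl.
  have s1 : (1 - q) ^+ size s <= 1 by rewrite exprn_ile1 // gerBl.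
  apply: le_trans (_ : expR (- p) ^+ n <= _).
    apply: lerXn2r; rewrite ?nnegrE ?expR_ge0 ?subr_ge0 //.
    by apply: le_trans (expR_ge1Dx _); rewrite lerD2l lerN2.
  rewrite -expRM_natr ler_expR mulNr lerNr opprK.
  apply: ler_wpM2l; first exact: exprn_ge0.
  by rewrite ler_pdivrMr // -natrM ler_nat muln2.
have := @no_free_perm_count R G 'I_k M s z.
rewrite /= !card_ord -/q => /(_ M0 k0 s_uniq z0 cover zle) count.
rewrite -(ler_nat R) natrM; apply: le_trans (ler_wpM2l (ler0n _ _) count) _.
rewrite [leLHS]mulrA ler_piMl // (le_trans _ small) // !natrM.
by rewrite le_eqVlt; apply/orP; left; apply/eqP; ring.
Qed.
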